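(* Let $a>1$ be an integer that is not a perfect square. For a prime $p\nmid a$, let $f_p=f_a(p)$ denote the multiplicative order of $a$ modulo $p$, let $e_p=(p-1)/f_p$, let $\zeta_p=e^{2\pi i/p}$, and let $g$ be a primitive root modulo $p$. For $i=1,\dots,e_p$ define the cyclotomic periods $$\eta_{i,p}=\sum_{j=1}^{f_p}\zeta_p^{\,g^i a^j},$$ and for $m\in\{1,\dots,p-1\}$ let $h_m\in\{1,\dots,p-1\}$ satisfy $h_m\equiv m f_p \pmod p$ and define $$\eta_{h_m,p}=\sum_{j=1}^{f_p}\zeta_p^{\,h_m a^j}.$$ For a positive integer $x$ and a nonzero integer $n$, let $\omega_x(n)$ denote the number of primes $p\le x$ dividing $n$. Then there is a constant $C$ (independent of $x$ and $u$) such that for every integer $x\ge 3$ and every positive integer $u\le x$ the following two bounds hold: (A) $$\sum_{j\le u}\omega_x(a^j-1)\;\le\; C\,u\log\log x\;+\;u\sum_{\substack{p\le x\\ p\nmid a}}\frac{\sum_{i=1}^{e_p}|\eta_{i,p}|}{p};$$ (B) $$\sum_{j\le u}\omega_x(a^j-1)\;\le\; C\,u\log\log x\;+\;2\pi u\sum_{\substack{p\le x\\ p\nmid a}}\frac{\sum_{k=1}^{p-2}\left|\sum_{m=1}^{k}\eta_{h_m,p}\right|}{p^2}.$$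
   Context: Sums over $p$ range over primes. The term $C\,u\log\log x$ replaces the paper's $O(u\log\log x)$. The quantities $\eta_{i,p}$ do not depend on the choice of primitive root beyond a relabeling of $i$, and $g^i$ may be replaced by its least positive residue modulo $p$. *)

(* Defs.v *)
From HB Require Import structures.
From mathcomp Require Import all_boot all_order all_algebra all_fingroup.
From mathcomp Require Import complex.
From mathcomp Require Import all_classical all_reals all_analysis.

Set Implicit Arguments.
Unset Strict Implicit.
Unset Printing Implicit Defensive.

Import Order.TTheory GRing.Theory Num.Theory.
Local Open Scope ring_scope.

(* The default value [1] of [insubd] is only taken when [p] divides [a]. *)
Definition modunit (a p : nat) : {unit 'F_p} := insubd (1%g : {unit 'F_p}) a%:R.

Definition mulord (a p : nat) : nat := #[modunit a p]%g.

Definition mulindex (a p : nat) : nat := (p.-1 %/ mulord a p)%N.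

Definition primroot_mod (p g : nat) : bool :=
  p.-1.-primitive_root (g%:R : 'F_p).

Definition zeta (R : realType) (p : nat) : R[i] :=
  (cos (2 * pi / p%:R) +i* sin (2 * pi / p%:R))%C.

(* eta_{i,p} is [period R a p (g ^ i)] and eta_{h_m,p} is
   [period R a p (hres a p m)]. *)
Definition period (R : realType) (a p b : nat) : R[i] :=
  \sum_(1 <= j < (mulord a p).+1) zeta R p ^+ (b * a ^ j)%N.

Definition hres (a p m : nat) : nat := ((m * mulord a p) %% p)%N.

Definition omega_upto (x n : nat) : nat :=
  #|[set p : 'I_x.+1 | prime p && (p %| n)%N]|.

(* Real-valued modulus; [`|z|] on [R[i]] takes its values in [R[i]]. *)
Definition cmod (R : realType) (z : R[i]) : R := Normc.normc z.

(* Main.v *)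
(** Exchanging sums, the left-hand side is the sum over the primes [p <= x],
    [p] not dividing [a], of [u %/ f_p], so it suffices to compare [1 / f_p]
    with [2 / p] plus the [p]-th term of each bound and to use
    [\sum_(p <= x) 1 / p = O(ln (ln x))]; the latter holds because the primes
    of [(2^k, 2^k.+1]] divide the central binomial coefficient, hence
    contribute at most [2 / k].  For a fixed [p], both comparisons come from
    [\sum_(1 <= m < p) eta_(m c) zeta^(- m c) = p - f_p], valid for [c] prime to
    [p].  With [c = 1], bounding the sum by absolute values and noting that each
    of the [e_p] periods occurs [f_p] times gives (A).  With [c = f_p], summation
    by parts gives (B), since [|zeta^f_p - 1| <= 2 pi f_p / p] and the full sum
    [\sum_(1 <= m < p) eta_(m f_p)] is only [- f_p]. *)

Require Import Defs.
From HB Require Import structures.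
From mathcomp Require Import all_boot all_order all_algebra all_fingroup.
From mathcomp Require Import complex.
From mathcomp Require Import all_classical all_reals all_analysis.
From mathcomp Require Import ring lra zify.

Set Implicit Arguments.
Unset Strict Implicit.
Unset Printing Implicit Defensive.

Import Order.TTheory GRing.Theory Num.Theory.
Local Open Scope ring_scope.

(** * Chebyshev-type count of the primes in a dyadic interval *)

Lemma prime_dvd_fact (p n : nat) : prime p -> (p %| n`!)%N -> (p <= n)%N.
Proof.
move=> p_pr; elim: n => [|n IHn]; first by rewrite fact0 Euclid_dvd1.
rewrite factS Euclid_dvdM // => /orP[/dvdn_leq->//|/IHn]; exact: leqW.
Qed.

Lemma leq_bin_expn (n k : nat) : ('C(n, k) <= 2 ^ n)%N.
Proof.
elim: n k => [|n IHn] [|k]; rewrite ?bin0 ?bin0n ?expn_gt0 //.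
by rewrite binS expnS mul2n -addnn leq_add.
Qed.

(** A prime of [(n, 2n]] divides [(2n)! = 'C(2n, n) * n! * n!] but not [n!], and distinct primes are
    coprime. *)
Lemma prod_primes_dvd_central_bin (n : nat) :
  (\prod_(n.+1 <= p < n.*2.+1 | prime p) p %| 'C(n.*2, n))%N.
Proof.
apply/unstable.Gauss_dvd_prod.
  rewrite map_id; apply: (@sub_in_pairwise _ prime ltn).
  - move=> p q p_pr q_pr /= lt_pq.
    by rewrite prime_coprime // dvdn_prime2 // neq_ltn lt_pq.
  - exact: filter_all.
  - rewrite -sorted_pairwise; last exact: ltn_trans.
    by apply: sorted_filter; [exact: ltn_trans | exact: iota_ltn_sorted].
move=> p; rewrite mem_index_iota => /andP[lt_np le_p2n] p_pr.
have := @bin_fact n.*2 n; rewrite -addnn leq_addl addnK => /(_ isT) fE.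
have : (p %| (n + n)`!)%N by rewrite dvdn_fact // prime_gt0 //= addnn.
rewrite -fE !Euclid_dvdM // => /orP[//|].
by rewrite orbb => /(prime_dvd_fact p_pr); rewrite leqNgt lt_np.
Qed.

(** If the interval holds [N] primes, their product is at least [2 ^ (k N)] and at most the central
    binomial coefficient, hence at most [2 ^ (2 ^ k.+1)]; compare exponents. *)
Lemma count_primes_dyadic (k : nat) :
  (k * \sum_((2 ^ k).+1 <= p < (2 ^ k.+1).+1 | prime p) 1 <= 2 ^ k.+1)%N.
Proof.
rewrite -(@leq_exp2l 2) // expnM expn_sum.
have E : (2 ^ k.+1 = (2 ^ k).*2)%N by rewrite expnS mul2n.
rewrite {1}E.
apply: leq_trans (leq_bin_expn (2 ^ k.+1) (2 ^ k)); rewrite E.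
apply: leq_trans (dvdn_leq _ (prod_primes_dvd_central_bin _)); last first.
  by rewrite bin_gt0 -addnn leq_addl.
rewrite big_nat_cond [leqRHS]big_nat_cond.
by apply: leq_prod => p /andP[/andP[/ltnW le_p _] _]; rewrite expn1.
Qed.

(** * Upper bound of Mertens type for the sum of prime reciprocals *)

Section PrimeReciprocals.
Variable R : realType.

Lemma sum_prime_recip_dyadic (k : nat) : (0 < k)%N ->
  \sum_((2 ^ k).+1 <= p < (2 ^ k.+1).+1 | prime p) p%:R^-1 <= 2 / k%:R :> R.
Proof.
move=> k_gt0; have k_gt0R : 0 < k%:R :> R by rewrite ltr0n.
have e_gt0 : 0 < (2 ^ k)%N%:R :> R by rewrite ltr0n expn_gt0.
apply: (@le_trans _ _ (\sum_((2 ^ k).+1 <= p < (2 ^ k.+1).+1 | prime p)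
                         (2 ^ k)%N%:R^-1)).
  rewrite big_nat_cond [leRHS]big_nat_cond.
  apply: ler_sum => p /andP[/andP[lt_p _] _].
  rewrite lef_pV2 ?posrE ?ltr0n ?expn_gt0 ?(leq_trans _ lt_p) //.
  by rewrite ler_nat ltnW.
rewrite (eq_bigr (fun=> (2 ^ k)%N%:R^-1 * (1%N)%:R)); last first.
  by move=> p _; rewrite mulr1.
rewrite -mulr_sumr -natr_sum mulrC ler_pdivlMr // mulrAC ler_pdivrMr //.
have := count_primes_dyadic k.
by rewrite -(ler_nat R) natrM expnS natrM [leLHS]mulrC.
Qed.

(** The inductive step is [1/(n+2) <= - ln (1 - 1/(n+2))], an instance of [ln (1 + t) <= t]. *)
Lemma ler_harmonic_ln (n : nat) :
  \sum_(1 <= k < n.+2) k%:R^-1 <= 1 + ln n.+1%:R :> R.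
Proof.
elim: n => [|n IHn]; first by rewrite big_nat1 invr1 ln1 addr0.
rewrite big_nat_recr //=; apply: le_trans (lerD IHn (lexx _)) _.
rewrite -addrA lerD2l -lerBrDl.
have n1_gt0 : 0 < n.+1%:R :> R by rewrite ltr0n.
have n2_gt0 : 0 < n.+2%:R :> R by rewrite ltr0n.
rewrite -ln_div ?posrE // -[leLHS]opprK -[leRHS]opprK lerN2.
rewrite -lnV ?posrE ?divr_gt0 // invf_div.
have -> : n.+1%:R / n.+2%:R = 1 + (- n.+2%:R^-1) :> R.
  by rewrite -[in LHS](addrK 1 n.+1%:R) natr1 mulrBl divff ?gt_eqF // mul1r.
by apply: le_ln1Dx; rewrite ltrN2 invf_lt1 // ltr1n.
Qed.

Lemma sum_prime_recip_pow2 (n : nat) :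
  \sum_(0 <= p < (2 ^ n.+2).+1 | prime p) p%:R^-1
    <= 1 + 2 * \sum_(1 <= k < n.+2) k%:R^-1 :> R.
Proof.
elim: n => [|n IHn].
  rewrite big_nat1 invr1 mulr1 big_mkcond /= !big_nat_recl //= big_geq //=.
  by rewrite !add0r !addr0; lra.
rewrite (@big_cat_nat _ _ _ (2 ^ n.+2).+1) //=; last by rewrite ltnS leq_exp2l.
rewrite [in leRHS]big_nat_recr //= mulrDr addrA.
by apply: lerD => //; apply: sum_prime_recip_dyadic.
Qed.

Lemma ln3_gt1 : 1 < ln 3 :> R.
Proof.
(* [1 / e >= (1 - 1/6) ^ 6 > 1/3]. *)
have e_gt0 : 0 < expR 1 :> R := expR_gt0 1.
rewrite -ltr_expR lnK ?posrE //.
have h : (5 / 6 : R) <= expR (- (6^-1)).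
  by apply: le_trans (expR_ge1Dx _); lra.
have : (5 / 6 : R) ^+ 6 <= expR (- 6^-1) ^+ 6.
  by rewrite lerXn2r ?nnegrE ?expR_ge0 //; lra.
rewrite -expRM_natl mulrN mulfV // expRN => h6.
have : 3^-1 < (expR 1)^-1 :> R by apply: lt_le_trans h6; lra.
by rewrite ltf_pV2 ?posrE.
Qed.

Lemma lnln_gt0 (x : nat) : (3 <= x)%N -> 0 < ln (ln x%:R) :> R.
Proof.
move=> x_ge3; apply: ln_gt0; apply: lt_le_trans ln3_gt1 _.
by rewrite ler_ln ?posrE ?ltr0n ?(leq_trans _ x_ge3) // ler_nat.
Qed.

Lemma sum_prime_recip_lnln :
  exists C : R, forall x : nat, (3 <= x)%N ->
    \sum_(0 <= p < x.+1 | prime p) p%:R^-1 <= C * ln (ln x%:R).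
Proof.
set D : R := - ln (ln 2).
have ll3 := @lnln_gt0 3 isT.
(* The bound obtained below is [3 + 2 D + 2 ln (ln x)]; dividing by [ln (ln 3) > 0] lets the
   additive constant be absorbed for every [x >= 3]. *)
exists ((3 + 2 * `|D|) / ln (ln 3%:R) + 2).
move=> x x_ge3; have x_gt0 : (0 < x)%N by apply: leq_trans x_ge3.
have /andP[le_x lt_x] := @trunc_log_bounds 2 x isT x_gt0.
have : (0 < trunc_log 2 x)%N by rewrite trunc_log_gt0 /= (ltnW x_ge3).
(* From here on [2 ^ n.+1 <= x < 2 ^ n.+2]; the lower bound controls [ln n.+1], the upper one lets
   the sum be extended to whole dyadic blocks. *)
case: (trunc_log 2 x) le_x lt_x => // n le_x lt_x _.
have ln2_gt0 : 0 < ln 2 :> R by apply: ln_gt0; rewrite ltr1n.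
have lnx_gt1 : 1 < ln x%:R :> R.
  apply: lt_le_trans ln3_gt1 _.
  by rewrite ler_ln ?posrE ?ltr0n // ler_nat.
have lnn : ln n.+1%:R <= ln (ln x%:R) + D.
  rewrite -ln_div ?posrE //; last exact: lt_trans lnx_gt1.
  rewrite ler_ln ?posrE ?ltr0n ?divr_gt0 //; last exact: lt_trans lnx_gt1.
  rewrite ler_pdivlMr // mulr_natl -lnXn // -natrX.
  by rewrite ler_ln ?posrE ?ltr0n ?expn_gt0 // ler_nat.
have le3 : 3 + 2 * `|D| <= (3 + 2 * `|D|) / ln (ln 3%:R) * ln (ln x%:R).
  rewrite mulrAC ler_pdivlMr //; apply: ler_wpM2l.
    by rewrite addr_ge0 ?mulr_ge0.
  rewrite ler_ln ?posrE; last 2 first.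
  - exact: lt_trans ln3_gt1.
  - exact: lt_trans lnx_gt1.
  by rewrite ler_ln ?posrE ?ltr0n // ler_nat.
apply: (@le_trans _ _ (\sum_(0 <= p < (2 ^ n.+2).+1 | prime p) p%:R^-1)).
  rewrite [leRHS](@big_cat_nat _ _ _ x.+1) //=; last by rewrite ltnW.
  by rewrite lerDl; apply: sumr_ge0 => p _; rewrite invr_ge0.
apply: le_trans (sum_prime_recip_pow2 n) _.
have := ler_harmonic_ln n; have := ler_norm D; rewrite mulrDl; lra.
Qed.

End PrimeReciprocals.

(** * The real-valued modulus *)

Section ComplexModulus.
Variable R : realType.
Implicit Types x y : R[i].

Lemma cmod_ge0 x : 0 <= cmod x.
Proof. by case: x => a b; apply: sqrtr_ge0. Qed.

Lemma cmod0 : cmod (0 : R[i]) = 0. Proof. exact: Normc.normc0. Qed.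

Lemma cmodD x y : cmod (x + y) <= cmod x + cmod y.
Proof. exact: le_normcD. Qed.

Lemma cmodN x : cmod (- x) = cmod x. Proof. exact: normcN. Qed.

Lemma cmodM x y : cmod (x * y) = cmod x * cmod y.
Proof. exact: Normc.normcM. Qed.

Lemma cmodV x : cmod x^-1 = (cmod x)^-1.
Proof. exact: Normc.normcV. Qed.

Lemma cmodX x n : cmod (x ^+ n) = cmod x ^+ n.
Proof.
elim: n => [|n IHn]; first exact: Normc.normc1.
by rewrite !exprS cmodM IHn.
Qed.

Lemma cmod_sum (I : Type) (r : seq I) (P : pred I) (F : I -> R[i]) :
  cmod (\sum_(i <- r | P i) F i) <= \sum_(i <- r | P i) cmod (F i).
Proof.
elim/big_rec2: _ => [|i y x _ le_xy]; first by rewrite cmod0.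
by apply: le_trans (cmodD _ _) _; rewrite lerD2l.
Qed.

Lemma cmod_nat (n : nat) : cmod (n%:R : R[i]) = n%:R.
Proof.
rewrite -(rmorph_nat (real_complex R)) /cmod /=.
by rewrite expr0n addr0 sqrtr_sqr normr_nat.
Qed.

End ComplexModulus.

(** * The root of unity [zeta]: primitivity, distance to 1, orthogonality *)

Lemma sin_le_id (R : realType) (t : R) : 0 <= t -> sin t <= t.
Proof.
move=> t_ge0.
have [c _] : exists2 c, c \in `[0, t] & sin t - sin 0 = cos c * (t - 0).
  apply: MVT_segment => //.
  by apply: derivable_within_continuous => x _; apply: ex_derive.
rewrite sin0 !subr0 => ->; rewrite -[leRHS]mul1r.
by apply: ler_wpM2r => //; apply: cos_le1.
Qed.

Section Zeta.
Variables (R : realType) (p : nat).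
Hypothesis p_pr : prime p.
Local Notation z := (zeta R p).

Let p_gt0R : 0 < p%:R :> R. Proof. by rewrite ltr0n prime_gt0. Qed.

Lemma zetaX n : z ^+ n =
  (cos (n%:R * (2 * pi / p%:R)) +i* sin (n%:R * (2 * pi / p%:R)))%C.
Proof.
elim: n => [|n IHn]; first by rewrite expr0 mul0r cos0 sin0.
rewrite exprSr IHn -[n.+1%:R]natr1 [in RHS]mulrDl mul1r cosD sinD.
by congr (_ +i* _)%C; rewrite addrC.
Qed.

Lemma cmod_zeta : cmod z = 1.
Proof. by rewrite /cmod /= cos2Dsin2 sqrtr1. Qed.

Lemma cmod_zetaX n : cmod (z ^+ n) = 1.
Proof. by rewrite cmodX cmod_zeta expr1n. Qed.

Lemma zeta_neq0 : z != 0.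
Proof.
apply/eqP => z0; have := cmod_zeta; rewrite z0 cmod0 => /eqP.
by rewrite eq_sym oner_eq0.
Qed.

Lemma zetaXp : z ^+ p = 1.
Proof.
rewrite zetaX mulrC divfK ?gt_eqF // mulrC mulr_natr.
by rewrite cos2pi -[pi *+ 2]add0r sinD2pi sin0.
Qed.

Lemma zeta_neq1 : z != 1.
Proof.
apply/eqP => /eqP; rewrite eq_complex /= => /andP[/eqP cos1 /eqP sin0].
(* For [p = 2] the cosine is -1; for [p > 2] the angle lies strictly between 0 and [pi], so the sine
   is positive. *)
have := prime_gt1 p_pr; rewrite leq_eqVlt => /orP[/eqP p2 | p_gt2].
  move: cos1; rewrite -p2 mulrAC divff ?mul1r ?pnatr_eq0 // cospi; lra.
suff : 0 < sin (2 * pi / p%:R : R) by rewrite sin0 ltxx.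
apply: sin_gt0_pi; rewrite divr_gt0 ?mulr_gt0 ?pi_gt0 //=.
by rewrite ltr_pdivrMr // mulrC ltr_pM2l ?pi_gt0 // ltr_nat.
Qed.

Lemma zeta_prim : p.-primitive_root z.
Proof.
have [m m_prim] := prim_order_exists (prime_gt0 p_pr) zetaXp.
case/primeP: p_pr => _ dvd_p /dvd_p /orP[] /eqP mE; last by rewrite -{1}mE.
move: (prim_expr_order m_prim) zeta_neq1.
by rewrite mE expr1 => ->; rewrite eqxx.
Qed.

Lemma zetaX_dvd n : (z ^+ n == 1) = (p %| n)%N.
Proof. by rewrite (prim_order_dvd zeta_prim). Qed.

Lemma zetaX_mod n : z ^+ (n %% p) = z ^+ n.
Proof. exact: prim_expr_mod zeta_prim n. Qed.

(** The chord has length [2 sin (pi / p)] by the half-angle formulas. *)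
Lemma cmod_zeta_sub1 : cmod (z - 1) <= 2 * pi / p%:R.
Proof.
set t : R := pi / p%:R.
have tE : 2 * pi / p%:R = t *+ 2 by rewrite -mulrA mulr_natl.
have t_ge0 : 0 <= t by rewrite divr_ge0 // pi_ge0.
have t_lepi : t <= pi.
  by rewrite ler_pdivrMr // ler_peMr ?pi_ge0 // ler1n prime_gt0.
have st_ge0 : 0 <= sin t by apply: sin_ge0_pi; rewrite t_ge0.
rewrite /cmod /= tE oppr0 addr0.
have -> : (cos (t *+ 2) - 1) ^+ 2 + sin (t *+ 2) ^+ 2 = (sin t *+ 2) ^+ 2.
  rewrite sin2cos2 cos_mulr2n cos2sin2; ring.
by rewrite sqrtr_sqr ger0_norm ?mulrn_wge0 // lerMn2r /= sin_le_id.
Qed.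

Lemma cmod_zetaX_sub1 n : cmod (z ^+ n - 1) <= n%:R * (2 * pi / p%:R).
Proof.
rewrite subrX1 cmodM mulrC; apply: ler_pM; rewrite ?cmod_ge0 ?cmod_zeta_sub1 //.
apply: le_trans (cmod_sum _ _ _) _.
rewrite (eq_bigr (fun=> 1)); last by move=> i _; rewrite cmod_zetaX.
by rewrite sumr_const card_ord.
Qed.

(** Orthogonality from the geometric sum over [0 <= m < p]; the -1 removes the term [m = 0]. *)
Lemma sum_zetaX d :
  \sum_(1 <= m < p) z ^+ (m * d) = p%:R * (p %| d)%N%:R - 1.
Proof.
have E : \sum_(0 <= m < p) z ^+ (m * d) = p%:R * (p %| d)%N%:R.
  under eq_bigr do rewrite mulnC exprM; rewrite big_mkord.
  have [p_d|p_nd] := boolP (p %| d)%N.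
    move: p_d; rewrite -zetaX_dvd => /eqP ->.
    under eq_bigr do rewrite expr1n.
    by rewrite sumr_const card_ord mulr1.
  have nz : z ^+ d - 1 != 0 by rewrite subr_eq0 zetaX_dvd.
  apply: (mulfI nz); rewrite !mulr0 -subrX1 -exprM mulnC exprM.
  by rewrite zetaXp expr1n subrr.
by rewrite -E [in RHS]big_ltn ?prime_gt0 // mul0n expr0 addrAC subrr add0r.
Qed.

End Zeta.

(** * Primitive roots and the multiplicative order modulo [p] *)

Lemma Fp_natr_eq0 (p n : nat) :
  prime p -> (n%:R == 0 :> 'F_p) = (p %| n)%N.
Proof. by move=> p_pr; rewrite (dvdn_pcharf (pchar_Fp p_pr)). Qed.

Lemma perm_primroot_mod p g : prime p -> primroot_mod p g ->
  perm_eq [seq (g ^ k %% p)%N | k <- index_iota 1 p] (index_iota 1 p).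
Proof.
move=> p_pr g_prim.
have uniq_g : uniq [seq (g ^ k %% p)%N | k <- index_iota 1 p].
  rewrite map_inj_in_uniq ?iota_uniq // => i j.
  rewrite !mem_index_iota => /andP[i_gt0 lt_ip] /andP[j_gt0 lt_jp] gij.
  have : (g%:R : 'F_p) ^+ i == g%:R ^+ j.
    by rewrite -!natrX -val_eqE /= !val_Fp_nat // gij.
  (* Exponents run over [1..p-1]; shifted down by one they are reduced modulo [p - 1], so congruence
     becomes equality. *)
  rewrite (eq_prim_root_expr g_prim) -(prednK i_gt0) -(prednK j_gt0).
  rewrite -[i.-1.+1]addn1 -[j.-1.+1]addn1 eqn_modDr.
  rewrite !modn_small; [by move/eqP-> | lia | lia].
have sub_g : {subset [seq (g ^ k %% p)%N | k <- index_iota 1 p]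
              <= index_iota 1 p}.
  move=> _ /mapP[k _ ->]; rewrite mem_index_iota ltn_mod (prime_gt0 p_pr) andbT.
  rewrite lt0n -/(dvdn p (g ^ k)) -Fp_natr_eq0 // natrX.
  (* If [g ^ k] vanished, so would its power [g ^ (k (p-1))], which is 1. *)
  apply/eqP => g0.
  have := exprM (g%:R : 'F_p) k p.-1.
  rewrite g0 mulnC exprM (prim_expr_order g_prim) expr1n expr0n.
  by have := prime_gt1 p_pr; case: (p) => [|[|q]] //= _ /eqP; rewrite oner_eq0.
have [|_ gE] := uniq_min_size uniq_g sub_g; first by rewrite size_map.
by apply: uniq_perm => //; apply: iota_uniq.
Qed.

Section MultiplicativeOrder.
Variables (a p : nat).
Hypotheses (p_pr : prime p) (p_nda : ~~ (p %| a)%N).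

(** Moves the order from the unit group to the field, where the lemmas on primitive roots apply; [p]
    not dividing [a] rules out the default of [insubd]. *)
Lemma mulord_prim : (mulord a p).-primitive_root (a%:R : 'F_p).
Proof.
have aU : val (modunit a p) = a%:R :> 'F_p.
  by rewrite val_insubd unitfE Fp_natr_eq0 // p_nda.
have f_gt0 : (0 < mulord a p)%N by apply: order_gt0.
have af1 : (a%:R : 'F_p) ^+ mulord a p = 1.
  by rewrite -aU -FinRing.val_unitX expg_order FinRing.val_unit1.
have [m m_prim m_f] := prim_order_exists f_gt0 af1.
suff -> : mulord a p = m by [].
apply/eqP; rewrite eqn_dvd m_f andbT cyclic.order_dvdn; apply/eqP/val_inj.
by rewrite FinRing.val_unitX aU (prim_expr_order m_prim).
Qed.

Lemma mulord_gt0 : (0 < mulord a p)%N.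
Proof. exact: prim_order_gt0 mulord_prim. Qed.

Lemma mulord_dvd : (mulord a p %| p.-1)%N.
Proof.
rewrite (prim_order_dvd mulord_prim); apply/eqP.
(* Fermat's little theorem: cancel [a] in [a ^ p = a]. *)
have a_neq0 : a%:R != 0 :> 'F_p by rewrite Fp_natr_eq0 //.
apply: (mulfI a_neq0); rewrite mulr1 -exprS prednK ?prime_gt0 //.
by rewrite -[X in _ ^+ X](card_Fp p_pr) finfield.expf_card.
Qed.

Lemma mulord_lt : (mulord a p < p)%N.
Proof.
have p1_gt0 : (0 < p.-1)%N by rewrite -subn1 subn_gt0 prime_gt1.
by rewrite -[ltnRHS]prednK ?prime_gt0 // ltnS dvdn_leq // mulord_dvd.
Qed.

Let a_gt0 : (0 < a)%N.
Proof. by case: a p_nda => //; rewrite dvdn0. Qed.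

Lemma dvdn_mulord n : (p %| a ^ n - 1)%N = (mulord a p %| n)%N.
Proof.
rewrite -Fp_natr_eq0 // natrB ?expn_gt0 ?a_gt0 // natrX subr_eq0.
by rewrite (prim_order_dvd mulord_prim).
Qed.

(** As [e f = p - 1], [g ^ e] is an [f]-th root of unity, hence a power of [a]. This makes
    [period (g ^ i)] periodic in [i] with period [e]. *)
Lemma primroot_mod_mulindex g : primroot_mod p g ->
  exists s, g ^ mulindex a p = a ^ s %[mod p].
Proof.
move=> g_prim; have gef : (g%:R ^+ mulindex a p : 'F_p) ^+ mulord a p = 1.
  by rewrite -exprM divnK ?mulord_dvd // (prim_expr_order g_prim).
have [s gs] := prim_rootP mulord_prim gef.
exists s; have := congr1 (@nat_of_ord _) gs.
by rewrite -!natrX !val_Fp_nat.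
Qed.

End MultiplicativeOrder.

(** * Abel summation and sums of periodic sequences *)

Lemma summation_by_parts (A : comPzRingType) (b w : nat -> A) (n : nat) :
  \sum_(1 <= m < n.+2) b m * w m =
  (\sum_(1 <= m < n.+2) b m) * w n.+1
  + \sum_(1 <= k < n.+1) (\sum_(1 <= m < k.+1) b m) * (w k - w k.+1).
Proof.
elim: n => [|n IHn]; first by rewrite !big_nat1 big_geq // addr0.
rewrite big_nat_recr //= IHn [in RHS](big_nat_recr n.+2 1 b) //=.
rewrite [X in _ = _ + X]big_nat_recr //=.
set S := \sum_(1 <= m < n.+2) b m; set T := \sum_(1 <= k < n.+1) _; ring.
Qed.

Lemma sum_nat_periodic (V : nmodType) (F : nat -> V) (e n : nat) :
  (forall k, F (k + e)%N = F k) ->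
  \sum_(1 <= k < (n * e).+1) F k = (\sum_(1 <= i < e.+1) F i) *+ n.
Proof.
move=> Fe; elim: n => [|n IHn]; first by rewrite mul0n big_geq.
rewrite mulSn (@big_cat_nat _ _ _ e.+1) //=; last by rewrite ltnS leq_addr.
rewrite mulrS -IHn -[e.+1]add1n big_addn -addnS addKn.
by congr (_ + _); apply: eq_bigr => k _; rewrite Fe.
Qed.

(** * Cyclotomic periods and the two bounds on [1 / f] *)

Section Periods.
Variables (R : realType) (a p : nat).
Hypotheses (p_pr : prime p) (p_nda : ~~ (p %| a)%N).
Local Notation z := (zeta R p).
Local Notation f := (mulord a p).
Local Notation e := (mulindex a p).
Local Notation eta := (period R a p).

Let a_gt0 : (0 < a)%N.
Proof. by case: a p_nda => //; rewrite dvdn0. Qed.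

Lemma period_mod b : eta (b %% p) = eta b.
Proof.
apply: eq_bigr => j _.
by rewrite -(zetaX_mod R p_pr) modnMml (zetaX_mod R p_pr).
Qed.

Lemma period_eqmod b c : b = c %[mod p] -> eta b = eta c.
Proof. by move=> bc; rewrite -(period_mod b) bc period_mod. Qed.

(** Multiplying by [a] shifts [j] by one, and the term leaving the range reenters because
    [a ^ f = 1] modulo [p]. *)
Lemma period_mull b : eta (b * a) = eta b.
Proof.
have af1 : (a ^ f = 1 %[mod p])%N.
  by apply/eqP; rewrite eqn_mod_dvd ?expn_gt0 ?a_gt0 // dvdn_mulord.
rewrite /period; set G := fun j => z ^+ (b * a ^ j).
rewrite (eq_bigr (fun j => G j.+1)); last by move=> j _; rewrite -mulnA -expnS.
have f_gt0 := mulord_gt0 p_pr p_nda.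
rewrite big_nat_recr //= [RHS]big_ltn // [in RHS]big_add1 addrC; congr (_ + _).
rewrite /G -(zetaX_mod R p_pr) expnS mulnA -modnMmr af1 modnMmr muln1.
by rewrite expn1 (zetaX_mod R p_pr).
Qed.

Lemma period_mulX b s : eta (b * a ^ s) = eta b.
Proof.
by elim: s => [|s IHs]; rewrite ?muln1 // expnSr mulnA period_mull.
Qed.

(* Fourier inversion at 1 of the indicator function of the subgroup <a>. *)
Lemma sum_period_twist c : ~~ (p %| c)%N ->
  \sum_(1 <= m < p) eta (m * c) / z ^+ (m * c) = p%:R - f%:R.
Proof.
move=> p_ndc.
rewrite (eq_bigr (fun m =>
    \sum_(1 <= j < f.+1) z ^+ (m * (c * (a ^ j - 1))))); last first.
  move=> m _; rewrite mulr_suml; apply: eq_bigr => j _.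
  apply: (canLR (mulfK _)); first by rewrite expf_neq0 ?zeta_neq0.
  by rewrite -exprD mulnA -mulnSr -subSn ?expn_gt0 ?a_gt0 // subn1.
rewrite exchange_big /=.
under eq_bigr do rewrite (sum_zetaX R p_pr) Euclid_dvdM // (negPf p_ndc)
  (dvdn_mulord p_pr p_nda) /=.
rewrite sumrB sumr_const_nat subSS subn0; congr (_ - _).
(* Only [j = f] is a multiple of [f] in [1..f], so the divisible terms contribute a single [p]. *)
rewrite -mulr_sumr big_nat_recr ?mulord_gt0 //= dvdnn.
rewrite big_nat big1 ?add0r ?mulr1 // => j /andP[j_gt0 lt_jf].
by rewrite gtnNdvd.
Qed.

(** Since [p] does not divide [c * a ^ j], each of the [f] inner sums equals -1. *)
Lemma sum_period c : ~~ (p %| c)%N -> \sum_(1 <= m < p) eta (m * c) = - f%:R.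
Proof.
move=> p_ndc; rewrite /period exchange_big /=.
under eq_bigr do under eq_bigr do rewrite -mulnA.
under eq_bigr do rewrite (sum_zetaX R p_pr) Euclid_dvdM // (negPf p_ndc)
  Euclid_dvdX // (negPf p_nda) /= mulr0 add0r.
by rewrite sumr_const_nat subSS subn0 mulNrn.
Qed.

Let f_gt0R : 0 < f%:R :> R. Proof. by rewrite ltr0n mulord_gt0. Qed.
Let p_gt0R : 0 < p%:R :> R. Proof. by rewrite ltr0n prime_gt0. Qed.

Let cmod_p_sub_f : cmod (p%:R - f%:R : R[i]) = p%:R - f%:R.
Proof. by rewrite -!natrB ?cmod_nat // ltnW // mulord_lt. Qed.

Lemma mulord_inv_le_periods g : primroot_mod p g ->
  f%:R^-1 <= p%:R^-1 + (\sum_(1 <= i < e.+1) cmod (eta (g ^ i))) / p%:R.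
Proof.
move=> g_prim; set S := \sum_(_ <= _ < _) _.
have le_pf : p%:R - f%:R <= f%:R * S.
  have [s gs] := primroot_mod_mulindex p_pr p_nda g_prim.
  (* By periodicity [f * S] is the sum over all exponents [1..p-1], and [g ^ k %% p] then runs once
     through all nonzero residues. *)
  rewrite mulr_natl -sum_nat_periodic; last first.
    move=> k; congr cmod; rewrite -[RHS](period_mulX _ s).
    by apply: period_eqmod; rewrite expnD -modnMmr gs modnMmr.
  rewrite mulnC divnK ?mulord_dvd // prednK ?prime_gt0 //.
  rewrite (eq_bigr (fun k => cmod (eta (g ^ k %% p)))); last first.
    by move=> k _; rewrite period_mod.
  rewrite -(big_map (fun k => (g ^ k %% p)%N) xpredT (fun b => cmod (eta b))).
  rewrite (perm_big _ (perm_primroot_mod p_pr g_prim)) -cmod_p_sub_f.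
  have p_nd1 : ~~ (p %| 1)%N by rewrite Euclid_dvd1.
  rewrite -(sum_period_twist p_nd1); apply: le_trans (cmod_sum _ _ _) _.
  apply: ler_sum => m _.
  by rewrite muln1 cmodM cmodV cmod_zetaX invr1 mulr1.
(* After multiplication by [f * p] the claim is [p <= f + f * S]. *)
rewrite -(ler_pM2l f_gt0R) mulfV ?gt_eqF // -(ler_pM2r p_gt0R) mul1r.
suff -> : f%:R * (p%:R^-1 + S / p%:R) * p%:R = f%:R + f%:R * S by lra.
by field; rewrite gt_eqF.
Qed.

Lemma mulord_inv_le_period_sums :
  f%:R^-1 <= 2 / p%:R + 2 * pi *
    ((\sum_(1 <= k < (p - 2).+1)
        cmod (\sum_(1 <= m < k.+1) eta (hres a p m))) / p%:R ^+ 2).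
Proof.
set T := \sum_(_ <= _ < _) _.
have p_ndf : ~~ (p %| f)%N by rewrite gtnNdvd ?mulord_gt0 ?mulord_lt.
have hE m : eta (hres a p m) = eta (m * f) by apply: period_mod.
have le_pf : p%:R - f%:R <= f%:R + f%:R * (2 * pi / p%:R) * T.
  rewrite -cmod_p_sub_f -(sum_period_twist p_ndf).
  (* Puts the range [1 <= m < p] in the form of the summation by parts. *)
  have p2 : p = (p - 2).+2 by have := prime_gt1 p_pr; lia.
  have := summation_by_parts (fun m => eta (m * f))
    (fun m => (z ^+ (m * f))^-1) (p - 2).
  rewrite -p2 => ->.
  rewrite sum_period //; apply: le_trans (cmodD _ _) _; apply: lerD.
    (* The boundary term has modulus [f]; this second [f] is why the bound has [2 / p]. *)
    by rewrite cmodM cmodN cmod_nat cmodV cmod_zetaX invr1 mulr1.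
  apply: le_trans (cmod_sum _ _ _) _; rewrite mulr_sumr.
  apply: ler_sum => k _; under [in leRHS]eq_bigr do rewrite hE.
  rewrite cmodM mulrC ler_wpM2r ?cmod_ge0 //.
  set w := z ^+ (k.+1 * f).
  (* Consecutive weights differ by the factor [z ^+ f], so each difference has modulus at most
     [2 pi f / p]. *)
  have -> : (z ^+ (k * f))^-1 - w^-1 = w^-1 * (z ^+ f - 1).
    rewrite /w mulSn addnC exprD invfM mulrBr mulr1 divfK //.
    by rewrite expf_neq0 ?zeta_neq0.
  by rewrite cmodM cmodV cmod_zetaX invr1 mul1r cmod_zetaX_sub1.
rewrite -(ler_pM2l f_gt0R) mulfV ?gt_eqF // -(ler_pM2r p_gt0R) mul1r.
suff -> : f%:R * (2 / p%:R + 2 * pi * (T / p%:R ^+ 2)) * p%:R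
          = f%:R *+ 2 + f%:R * (2 * pi / p%:R) * T by lra.
by field; rewrite gt_eqF.
Qed.

End Periods.

(** * Exchange of summations and conclusion *)

Lemma sum_omega_upto (a x u : nat) : (1 < a)%N ->
  (\sum_(1 <= j < u.+1) omega_upto x (a ^ j - 1) =
   \sum_(0 <= p < x.+1 | prime p && ~~ (p %| a)) u %/ mulord a p)%N.
Proof.
move=> a_gt1.
have omegaE n : omega_upto x n = (\sum_(0 <= p < x.+1 | prime p) (p %| n))%N.
  rewrite /omega_upto -sum1_card big_mkord big_mkcond [RHS]big_mkcond /=.
  by apply: eq_bigr => p _; rewrite inE; case: prime; case: dvdn.
under eq_bigr do rewrite omegaE.
rewrite exchange_big /= [RHS]big_mkcondr /=; apply: eq_bigr => p p_pr.
case: ifP => [p_nda | /negbFE p_a].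
  (* What remains counts the multiples of the order among [1..u]. *)
  under eq_bigr do rewrite dvdn_mulord //.
  elim: u => [|u IHu]; first by rewrite big_geq // div0n.
  by rewrite big_nat_recr //= IHu divnS ?mulord_gt0 // addnC.
rewrite big_nat big1 // => j /andP[j_gt0 _]; apply/eqP; rewrite eqb0.
(* If [p] divides [a], then [a ^ j - 1] is -1 modulo [p], so such primes contribute nothing. *)
apply/negP => p_aj; have : (p %| a ^ j)%N by rewrite Euclid_dvdX // p_a.
rewrite -(subnK (_ : 1 <= a ^ j)%N) ?expn_gt0 ?(ltnW a_gt1) //.
by rewrite dvdn_addr // Euclid_dvd1.
Qed.

Theorem theorem1 (R : realType) (a : nat) (a_gt1 : (1 < a)%N)
    (a_nsq : forall b : nat, a <> (b ^ 2)%N) :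
  exists C : R,
    forall (g : nat -> nat),
      (forall p : nat, prime p -> ~~ (p %| a)%N -> primroot_mod p (g p)) ->
    forall x u : nat, (3 <= x)%N -> (0 < u)%N -> (u <= x)%N ->
    (\sum_(1 <= j < u.+1) omega_upto x (a ^ j - 1))%N%:R
      <= C * u%:R * ln (ln x%:R)
         + u%:R * \sum_(0 <= p < x.+1 | prime p && ~~ (p %| a)%N)
             ((\sum_(1 <= i < (mulindex a p).+1)
                 cmod (period R a p (g p ^ i)%N)) / p%:R)
    /\
    (\sum_(1 <= j < u.+1) omega_upto x (a ^ j - 1))%N%:R
      <= C * u%:R * ln (ln x%:R)
         + 2 * pi * u%:R * \sum_(0 <= p < x.+1 | prime p && ~~ (p %| a)%N)
             ((\sum_(1 <= k < (p - 2).+1)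
                 cmod (\sum_(1 <= m < k.+1) period R a p (hres a p m)))
              / p%:R ^+ 2).
Proof.
have [C le_C] := sum_prime_recip_lnln R.
exists (2 * C) => g g_prim x u x_ge3 u_gt0 _.
(* Both bounds follow from this with their own [X]; the [2 / p] terms give the constant [2 * C]. *)
have bound (X : nat -> R) :
    (forall p, prime p -> ~~ (p %| a)%N ->
       (mulord a p)%:R^-1 <= 2 / p%:R + X p) ->
    (\sum_(1 <= j < u.+1) omega_upto x (a ^ j - 1))%N%:R
      <= 2 * C * u%:R * ln (ln x%:R)
         + u%:R * \sum_(0 <= p < x.+1 | prime p && ~~ (p %| a)%N) X p.
  move=> leX; rewrite sum_omega_upto // natr_sum.
  apply: (@le_trans _ _ (\sum_(0 <= p < x.+1 | prime p && ~~ (p %| a)%N)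
                           u%:R * (2 / p%:R + X p))).
    apply: ler_sum => p /andP[p_pr p_nda].
    apply: le_trans (ler_wpM2l _ (leX p p_pr p_nda)) => //.
    rewrite ler_pdivlMr ?ltr0n ?mulord_gt0 // -natrM ler_nat.
    exact: leq_trunc_div.
  rewrite -mulr_sumr big_split /= mulrDr lerD2r -mulr_sumr.
  have -> : 2 * C * u%:R * ln (ln x%:R) = u%:R * (2 * (C * ln (ln x%:R))).
    by ring.
  rewrite !ler_wpM2l //; apply: le_trans (le_C x x_ge3).
  (* Primes dividing [a] may be added back, their reciprocals being nonnegative. *)
  rewrite [leLHS]big_mkcondr /=; apply: ler_sum => p _.
  by case: ifP => // _; rewrite invr_ge0.
split; last first.
  rewrite [2 * pi * u%:R]mulrC -[X in _ + X]mulrA mulr_sumr.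
  apply: bound => p p_pr p_nda.
  exact: mulord_inv_le_period_sums.
apply: bound => p p_pr p_nda.
apply: le_trans (mulord_inv_le_periods R p_pr p_nda (g_prim p p_pr p_nda)) _.
(* For (A) the term [1 / p] is weakened to [2 / p] to fit the common form. *)
by rewrite lerD2r ler_pMl ?invr_gt0 ?ltr0n ?prime_gt0 // ler1n.
Qed.
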